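(* Let $d\ge2$, $\varepsilon\ge1$, $s=\lceil d/(1+e^\varepsilon)\rceil$. Let $q^{\mathrm{ss}}$ be the $\varepsilon$-LDP $\texttt{Subset Selection}$ mechanism with estimator $\hat{\mathbf{x}}^{\mathrm{ss}}=(\mathbf{z}-b_{\mathrm{ss}}\mathbf{1})/m_{\mathrm{ss}}$, and let $q^{\mathrm{mrc}}$ be the MRC mechanism simulating it with $N$ candidates and estimator $\hat{\mathbf{x}}^{\mathrm{mrc}}=(\mathbf{z}_K-b_{\mathrm{mrc}}\mathbf{1})/m_{\mathrm{mrc}}$. Let $\lambda>0$. If \[ N\ge\frac{2(e^\varepsilon+3)^2(1+\lambda)^2}{0.24^2\lambda^2}\ln\Big(\frac{8(1+\lambda)}{0.24\lambda}\Big), \] then for every $\mathbf{x}\in\{e_1,\dots,e_d\}$, \[ \mathbb{E}_{q^{\mathrm{mrc}}}\big[\|\hat{\mathbf{x}}^{\mathrm{mrc}}-\mathbf{x}\|_2^2\big]\le(1+4\lambda+5\lambda^2+2\lambda^3)\,\mathbb{E}_{q^{\mathrm{ss}}}\big[\|\hat{\mathbf{x}}^{\mathrm{ss}}-\mathbf{x}\|_2^2\big]. \]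
   Context: $\texttt{Subset Selection}$: inputs $\{e_1,\dots,e_d\}$ (standard basis); outputs $\mathcal{Z}=\{\mathbf{z}\in\{0,1\}^d:\sum_iz_i=s\}$; for $\mathbf{x}=e_j$, $q^{\mathrm{ss}}(\mathbf{z}\mid\mathbf{x})=\frac{e^\varepsilon}{\binom{d-1}{s-1}e^\varepsilon+\binom{d-1}{s}}$ if $z_j=1$ and $\frac{1}{\binom{d-1}{s-1}e^\varepsilon+\binom{d-1}{s}}$ otherwise; $m_{\mathrm{ss}}=\frac{s(d-s)(e^\varepsilon-1)}{(d-1)(s(e^\varepsilon-1)+d)}$, $b_{\mathrm{ss}}=\frac{s((s-1)e^\varepsilon+(d-s))}{(d-1)(s(e^\varepsilon-1)+d)}$; $\mathbf{1}$ is the all-ones vector. MRC: draw $\mathbf{z}_1,\dots,\mathbf{z}_N$ i.i.d. uniform on $\mathcal{Z}$, $\pi^{\mathrm{mrc}}(k)=q^{\mathrm{ss}}(\mathbf{z}_k\mid\mathbf{x})/\sum_{k'}q^{\mathrm{ss}}(\mathbf{z}_{k'}\mid\mathbf{x})$, $K\sim\pi^{\mathrm{mrc}}$. Let $\theta$ be a random variable with $N\theta\sim\mathrm{Binom}(N,s/d)$ and define $m_{\mathrm{mrc}}=\mathbb{E}\big[\frac{\theta e^\varepsilon}{e^\varepsilon\theta+(1-\theta)}\big]-\frac{1}{d-1}\mathbb{E}\big[s-\frac{e^\varepsilon\theta}{e^\varepsilon\theta+(1-\theta)}\big]$ and $b_{\mathrm{mrc}}=\frac{1}{d-1}\mathbb{E}\big[s-\frac{e^\varepsilon\theta}{e^\varepsilon\theta+(1-\theta)}\big]$.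 Expectations under $q^{\mathrm{mrc}}$ are over the candidates and $K$. *)

(* Defs.v *)
From HB Require Import structures.
From mathcomp Require Import all_boot all_order all_algebra.
From mathcomp Require Import all_classical all_reals all_analysis.
Set Implicit Arguments. Unset Strict Implicit. Unset Printing Implicit Defensive.
Import Order.TTheory GRing.Theory Num.Theory.
Local Open Scope ring_scope.

Section SubsetSelection.
Variable R : realType.

(* s = ceil(d / (1 + e^eps)), as a natural number (the ceiling is positive) *)
Definition ss_s (d : nat) (eps : R) : nat :=
  `|Num.ceil (d%:R / (1 + expR eps))|%N.

Definition Zset (d s : nat) : {set {ffun 'I_d -> bool}} :=
  [set z : {ffun 'I_d -> bool} | (\sum_(i < d) (z i : nat))%N == s].

Definition q_ss (d s : nat) (eps : R) (j : 'I_d) (z : {ffun 'I_d -> bool}) : R :=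
  (if z j then expR eps else 1) /
  ('C(d.-1, s.-1)%:R * expR eps + 'C(d.-1, s)%:R).

Definition m_ss (d s : nat) (eps : R) : R :=
  (s%:R * (d%:R - s%:R) * (expR eps - 1)) /
  ((d%:R - 1) * (s%:R * (expR eps - 1) + d%:R)).

Definition b_ss (d s : nat) (eps : R) : R :=
  (s%:R * ((s%:R - 1) * expR eps + (d%:R - s%:R))) /
  ((d%:R - 1) * (s%:R * (expR eps - 1) + d%:R)).

Definition sqerr (d : nat) (m b : R) (j : 'I_d) (z : {ffun 'I_d -> bool}) : R :=
  \sum_(i < d) (((z i)%:R - b) / m - (i == j)%:R) ^+ 2.

Definition mse_ss (d s : nat) (eps : R) (j : 'I_d) : R :=
  \sum_(z in Zset d s) q_ss s eps j z * sqerr (m_ss d s eps) (b_ss d s eps) j z.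

Definition Ebinom (N : nat) (p : R) (f : R -> R) : R :=
  \sum_(i < N.+1) 'C(N, i)%:R * p ^+ i * (1 - p) ^+ (N - i) * f (i%:R / N%:R).

Definition g_mrc (eps : R) (theta : R) : R :=
  expR eps * theta / (expR eps * theta + (1 - theta)).

Definition b_mrc (N d s : nat) (eps : R) : R :=
  (d%:R - 1)^-1 * Ebinom N (s%:R / d%:R) (fun t => s%:R - g_mrc eps t).

Definition m_mrc (N d s : nat) (eps : R) : R :=
  Ebinom N (s%:R / d%:R) (g_mrc eps)
  - (d%:R - 1)^-1 * Ebinom N (s%:R / d%:R) (fun t => s%:R - g_mrc eps t).

Definition Cands (N d s : nat) : {set {ffun 'I_N -> {ffun 'I_d -> bool}}} :=
  [set c : {ffun 'I_N -> {ffun 'I_d -> bool}} | [forall k, c k \in Zset d s]].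

Definition pi_mrc (N d s : nat) (eps : R) (j : 'I_d)
    (c : {ffun 'I_N -> {ffun 'I_d -> bool}}) (k : 'I_N) : R :=
  q_ss s eps j (c k) / \sum_(k' < N) q_ss s eps j (c k').

(* E_{q^mrc}[ || xhat^mrc - e_j ||^2 ]: candidates i.i.d. uniform on Z, K ~ pi^mrc *)
Definition mse_mrc (N d s : nat) (eps : R) (j : 'I_d) : R :=
  \sum_(c in Cands N d s)
    (#|Zset d s|%:R ^+ N)^-1 *
    \sum_(k < N) pi_mrc s eps j c k *
      sqerr (m_mrc N d s eps) (b_mrc N d s eps) j (c k).

End SubsetSelection.

(* Main.v *)
(** Both mean squared errors are the same function [prob_mse] of the probability
    [P] that the released subset contains the input coordinate: for an
    [s]-subset, the squared error is affine in that one bit.  Subset Selection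
    has [P = Q := g p] with [p = s / d] and [g = g_mrc eps]; MRC has
    [P = E (g theta)].  The function [g] is concave with an explicit second-order
    Taylor remainder, so the variance [p (1 - p) / N] of [theta] gives
    [0 <= Q - P <= delta (Q - p)] with [delta <= exp eps / N].  The slope
    [m = d / (d - 1) * (P - p)] thus loses at most a factor [1 + lambda] and the
    numerator of the error gains at most a factor [1 + 2 lambda], and
    [(1 + lambda)^2 (1 + 2 lambda)] is the claimed constant. *)

Require Import Defs.
From HB Require Import structures.
From mathcomp Require Import all_boot all_order all_algebra.
From mathcomp Require Import all_classical all_reals all_analysis.
From mathcomp Require Import ring lra.
Import Order.TTheory GRing.Theory Num.Theory.
Local Open Scope ring_scope.

(** * Moments of the binomial distribution *)

Section BinomialMoments.
Variable R : realType.
Implicit Types (p : R) (f g : nat -> R).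

Definition binom_mean (N : nat) p f : R :=
  \sum_(i < N.+1) 'C(N, i)%:R * p ^+ i * (1 - p) ^+ (N - i) * f i.

Lemma EbinomE N p (f : R -> R) :
  Ebinom N p f = binom_mean N p (fun i => f (i%:R / N%:R)).
Proof. by []. Qed.

(** Conditioning on one trial, which is Pascal's rule on the coefficients. Every moment below
    follows from it by induction on [N]. *)
Lemma binom_meanS N p f :
  binom_mean N.+1 p f =
  p * binom_mean N p (fun i => f i.+1) + (1 - p) * binom_mean N p f.
Proof.
rewrite /binom_mean big_ord_recl /= bin0 expr0 !mul1r.
under eq_bigr => i _ do rewrite binS natrD !mulrDl.
rewrite big_split /= addrCA addrA addrC; congr (_ + _).
  rewrite mulr_sumr; apply: eq_bigr => i _.
  by rewrite /bump /= add1n subSS exprS; ring.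
rewrite mulr_sumr.
(* The sum may be extended to the index [N.+1], whose coefficient ['C(N, N.+1)] is zero. *)
transitivity (\sum_(i < N.+2) 'C(N, i)%:R * p ^+ i * (1 - p) ^+ (N.+1 - i) * f i).
  by rewrite [RHS]big_ord_recl /= bin0 expr0 !mul1r addrC.
rewrite big_ord_recr /= bin_small // !mul0r addr0.
apply: eq_bigr => i _; rewrite subSn; last by rewrite -ltnS.
by rewrite exprS; ring.
Qed.

Lemma binom_meanD N p f g :
  binom_mean N p (fun i => f i + g i) = binom_mean N p f + binom_mean N p g.
Proof. by rewrite -big_split; apply: eq_bigr => i _; rewrite mulrDr. Qed.

Lemma binom_meanZ N p c f :
  binom_mean N p (fun i => c * f i) = c * binom_mean N p f.
Proof. by rewrite [RHS]mulr_sumr; apply: eq_bigr => i _; rewrite mulrCA. Qed.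

Lemma binom_mean_le N p f g : 0 <= p <= 1 ->
  (forall i, (i <= N)%N -> f i <= g i) -> binom_mean N p f <= binom_mean N p g.
Proof.
move=> /andP[p0 p1] fg; apply: ler_sum => i _.
apply: ler_wpM2l; last by apply: fg; rewrite -ltnS.
by rewrite !mulr_ge0 ?exprn_ge0 ?subr_ge0.
Qed.

Lemma binom_mean1 N p : binom_mean N p (fun=> 1) = 1.
Proof.
elim: N => [|N IH]; last by rewrite binom_meanS IH; ring.
by rewrite /binom_mean big_ord1 bin0 !expr0 !mulr1.
Qed.

Lemma binom_mean_cst N p c : binom_mean N p (fun=> c) = c.
Proof.
rewrite -[RHS]mulr1 -(binom_mean1 N p) -binom_meanZ.
by apply: eq_bigr => i _; rewrite mulr1.
Qed.

Lemma binom_mean_nat N p : binom_mean N p (fun i => i%:R) = N%:R * p.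
Proof.
elim: N => [|N IH]; first by rewrite /binom_mean big_ord1 mulr0 mul0r.
rewrite binom_meanS.
have -> : binom_mean N p (fun i => i.+1%:R) =
    binom_mean N p (fun i => i%:R + 1).
  by apply: eq_bigr => i _; rewrite -natr1.
by rewrite binom_meanD binom_mean_cst IH -natr1; ring.
Qed.

Lemma binom_mean_sqr N p :
  binom_mean N p (fun i => i%:R ^+ 2) = N%:R * p * (1 - p) + (N%:R * p) ^+ 2.
Proof.
elim: N => [|N IH].
  by rewrite /binom_mean big_ord1 expr0n mulr0 !mul0r expr0n addr0.
rewrite binom_meanS.
have -> : binom_mean N p (fun i => i.+1%:R ^+ 2) =
    binom_mean N p (fun i => i%:R ^+ 2 + (2 * i%:R + 1)).
  by apply: eq_bigr => i _; congr (_ * _); rewrite -natr1; ring.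
rewrite binom_meanD binom_meanD binom_meanZ binom_mean1 binom_mean_nat IH.
by rewrite -natr1; ring.
Qed.

Lemma EbinomD N p (f g : R -> R) :
  Ebinom N p (fun t => f t + g t) = Ebinom N p f + Ebinom N p g.
Proof. by rewrite !EbinomE -binom_meanD. Qed.

Lemma EbinomZ N p c (f : R -> R) :
  Ebinom N p (fun t => c * f t) = c * Ebinom N p f.
Proof. by rewrite !EbinomE -binom_meanZ. Qed.

Lemma Ebinom_cst N p c : Ebinom N p (fun=> c) = c.
Proof. by rewrite EbinomE binom_mean_cst. Qed.

Lemma EbinomBl N p c (f : R -> R) :
  Ebinom N p (fun t => c - f t) = c - Ebinom N p f.
Proof.
transitivity (Ebinom N p (fun t => c + -1 * f t)).
  by apply: eq_bigr => i _; rewrite mulN1r.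
by rewrite EbinomD EbinomZ Ebinom_cst mulN1r.
Qed.

Lemma Ebinom_le N p (f g : R -> R) : (0 < N)%N -> 0 <= p <= 1 ->
  (forall t, 0 <= t <= 1 -> f t <= g t) -> Ebinom N p f <= Ebinom N p g.
Proof.
move=> N0 p01 fg; rewrite !EbinomE; apply: binom_mean_le => // i iN; apply: fg.
by rewrite divr_ge0 //= ler_pdivrMr ?ltr0n // mul1r ler_nat.
Qed.

Lemma Ebinom_id N p : (0 < N)%N -> Ebinom N p id = p.
Proof.
move=> N0; have Nn : N%:R != 0 :> R by rewrite pnatr_eq0 -lt0n.
rewrite EbinomE.
transitivity (binom_mean N p (fun i => N%:R^-1 * i%:R)).
  by apply: eq_bigr => i _; rewrite [_^-1 * _]mulrC.
by rewrite binom_meanZ binom_mean_nat mulKf.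
Qed.

Lemma Ebinom_variance N p : (0 < N)%N ->
  Ebinom N p (fun t => (t - p) ^+ 2) = p * (1 - p) / N%:R.
Proof.
move=> N0; have Nn : N%:R != 0 :> R by rewrite pnatr_eq0 -lt0n.
rewrite EbinomE.
transitivity (binom_mean N p (fun i =>
    N%:R ^- 2 * i%:R ^+ 2 + (- 2 * p / N%:R * i%:R + p ^+ 2))).
  by apply: eq_bigr => i _; congr (_ * _); field.
rewrite !binom_meanD !binom_meanZ binom_mean_cst binom_mean_nat binom_mean_sqr.
by field.
Qed.

End BinomialMoments.

(** * Counting subsets and tuples of candidates *)

Section Counting.

Lemma sum_card_set (R : nzRingType) (N : nat) (F : nat -> R) :
  \sum_(A : {set 'I_N}) F #|A| = \sum_(i < N.+1) 'C(N, i)%:R * F i.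
Proof.
rewrite (partition_big (fun A : {set 'I_N} => inord #|A| : 'I_N.+1) predT) //=.
apply: eq_bigr => i _.
have cardE (A : {set 'I_N}) : (inord #|A| == i) = (#|A| == i).
  by rewrite -val_eqE /= inordK // ltnS -[X in (_ <= X)%N](card_ord N) max_card.
rewrite (eq_bigl (mem [set A : {set 'I_N} | #|A| == i]%SET)); last first.
  by move=> A; rewrite /= inE cardE.
rewrite (eq_bigr (fun=> F i)) => [|A]; last by rewrite /= inE => /eqP->.
by rewrite sumr_const card_draws card_ord mulr_natl.
Qed.

(** Once [A] is fixed, the constraint on [c] splits into independent ones at each index, so the
    tuples form a product family. *)
Lemma card_ffun_with_indicator (T : finType) (N : nat) (Z : {set T})
    (P : pred T) (A : {set 'I_N}) :
  #|[pred c : {ffun 'I_N -> T} | [forall k, c k \in Z]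
       && ([set k | P (c k)]%SET == A)]| =
  (#|[set z in Z | P z]%SET| ^ #|A| * #|[set z in Z | ~~ P z]%SET| ^ (N - #|A|))%N.
Proof.
pose S (k : 'I_N) :=
  if k \in A then [set z in Z | P z]%SET else [set z in Z | ~~ P z]%SET.
rewrite (eq_card (B := family (fun k => mem (S k)))); last first.
  move=> c; rewrite !inE; apply/andP/familyP.
    move=> [/forallP cZ /eqP cA] k; rewrite /S -cA !inE.
    by case: ifP => Pk; rewrite !inE cZ ?Pk.
  move=> cS; split.
    by apply/forallP => k; move: (cS k); rewrite /S; case: ifP => _; rewrite !inE => /andP[].
  apply/eqP/setP => k; rewrite inE; move: (cS k); rewrite /S.
  by case: ifP => _; rewrite !inE => /andP[_]; [|move/negbTE].
rewrite card_family foldrE big_map big_enum /=.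
rewrite (bigID (mem A)) /=; congr (_ * _)%N.
  by rewrite (eq_bigr (fun=> #|[set z in Z | P z]%SET|))
    ?prod_nat_const // => k kA; rewrite /S kA.
rewrite (eq_bigr (fun=> #|[set z in Z | ~~ P z]%SET|)); last first.
  by move=> k kA; rewrite /S (negbTE kA).
rewrite prod_nat_const; congr (_ ^ _)%N.
have := cardC (mem A); rewrite card_ord => cA.
by rewrite -[X in (X - _)%N]cA addKn.
Qed.

Lemma sum_indicator (d : nat) (z : {ffun 'I_d -> bool}) :
  (\sum_(i < d) (z i : nat))%N = #|[set i | z i]%SET|.
Proof.
rewrite -sum1_card [RHS]big_mkcond; apply: eq_bigr => i _.
by rewrite inE; case: (z i).
Qed.

(** A bit vector is identified with its support. Taking [B] full counts all of [Zset]; taking [B] as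
    the complement of [j] counts the vectors that vanish at [j]. *)
Lemma card_Zset_sub d s (B : {set 'I_d}) :
  #|[set z in Zset d s | [set i | z i]%SET \subset B]%SET| = 'C(#|B|, s).
Proof.
rewrite -cards_draws.
have supp_inj : injective (fun z : {ffun 'I_d -> bool} => [set i | z i]%SET).
  by move=> z w /setP zw; apply/ffunP => i; have := zw i; rewrite !inE.
rewrite -(card_imset _ supp_inj); apply: eq_card => A; rewrite inE.
apply/imsetP/andP.
  by move=> [z + ->]; rewrite !inE sum_indicator => /andP[-> ->].
move=> [AB As]; pose z := [ffun i => i \in A].
have zA : [set i | z i]%SET = A by apply/setP => i; rewrite inE ffunE.
by exists z => //; rewrite !inE sum_indicator zA AB As.
Qed.

Lemma card_Zset d s : #|Zset d s| = 'C(d, s).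
Proof.
have := card_Zset_sub d s [set: 'I_d]%SET; rewrite cardsT card_ord => <-.
apply: eq_card => z.
by rewrite !inE finset.subsetT andbT.
Qed.

Lemma card_Zset_notin d s (j : 'I_d) :
  #|[set z in Zset d s | ~~ z j]%SET| = 'C(d.-1, s).
Proof.
have -> : d.-1 = #|[set~ j]%SET| by rewrite cardsC1 card_ord.
rewrite -card_Zset_sub; apply: eq_card => z; rewrite !inE; congr (_ && _).
apply/idP/fintype.subsetP => [zj i|/(_ j)].
  by rewrite !inE; apply: contraTneq => ->.
by rewrite !inE eqxx; case: (z j) => // /(_ isT).
Qed.

Lemma card_Zset_in d s (j : 'I_d) : (0 < s)%N ->
  #|[set z in Zset d s | z j]%SET| = 'C(d.-1, s.-1).
Proof.
move=> s0; apply/eqP; rewrite -(eqn_add2l 'C(d.-1, s)); apply/eqP.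
have := cardsID [set z : {ffun 'I_d -> bool} | z j]%SET (Zset d s).
rewrite card_Zset addnC => dE.
transitivity 'C(d, s); last first.
  by case: d s j s0 {dE} => [|d] [|s] [] // k kd _; rewrite binS.
rewrite -dE -(card_Zset_notin d s j).
by congr (_ + _)%N; apply: eq_card => z; rewrite !inE // andbC.
Qed.

End Counting.

(** * Distribution of the number of candidates that contain the input coordinate *)

Section CandidateCounts.
Variable R : realType.

(** For i.i.d. uniform draws from [Z], the number of draws satisfying [P] is binomial. This is where
    the law of [N * theta] comes from. *)
Lemma mean_indicator_count (T : finType) (N : nat) (Z : {set T}) (P : pred T)
    (F : nat -> R) : (0 < #|Z|)%N ->
  \sum_(c : {ffun 'I_N -> T} | [forall k, c k \in Z])
    (#|Z|%:R ^+ N)^-1 * F #|[set k | P (c k)]%SET| =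
  binom_mean R N (#|[set z in Z | P z]%SET|%:R / #|Z|%:R) F.
Proof.
move=> Z0; have Zn : #|Z|%:R != 0 :> R by rewrite pnatr_eq0 -lt0n.
set a := #|[set z in Z | P z]%SET|; set b := #|[set z in Z | ~~ P z]%SET|.
have abE : (a + b)%N = #|Z|.
  rewrite -(cardsID [set z | P z]%SET Z) /a /b.
  by congr (_ + _)%N; apply: eq_card => z; rewrite !inE // andbC.
(* Tuples are grouped by the set [A] of indices where [P] holds; each group has
   [a ^ #|A| * b ^ (N - #|A|)] elements. *)
rewrite (partition_big (fun c : {ffun 'I_N -> T} => [set k | P (c k)]%SET) predT) //=.
transitivity (\sum_(A : {set 'I_N})
    (a%:R / #|Z|%:R) ^+ #|A| * (b%:R / #|Z|%:R) ^+ (N - #|A|) * F #|A| : R).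
  apply: eq_bigr => A _.
  rewrite (eq_bigr (fun=> (#|Z|%:R ^+ N)^-1 * F #|A|)); last first.
    by move=> c /andP[_ /eqP->].
  rewrite sumr_const card_ffun_with_indicator -/a -/b -[LHS]mulr_natl natrM !natrX.
  have AN : (#|A| <= N)%N by rewrite -[X in (_ <= X)%N](card_ord N) max_card.
  have ZN : #|Z|%:R ^+ N = #|Z|%:R ^+ #|A| * #|Z|%:R ^+ (N - #|A|) :> R.
    by rewrite -exprD subnKC.
  by rewrite !expr_div_n ZN invfM; ring.
rewrite (sum_card_set _ _ (fun i => (a%:R / #|Z|%:R) ^+ i *
  (b%:R / #|Z|%:R) ^+ (N - i) * F i)).
apply: eq_bigr => i _; rewrite !mulrA; congr (_ * _ ^+ _ * _).
by rewrite -abE natrD; field; rewrite -natrD abE.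
Qed.

Lemma card_Zset_ratio d s (j : 'I_d) : (0 < s <= d)%N ->
  #|[set z in Zset d s | z j]%SET|%:R / #|Zset d s|%:R = s%:R / d%:R :> R.
Proof.
move=> /andP[s0 sd]; rewrite card_Zset_in // card_Zset.
have d0 : (0 < d)%N by apply: leq_trans s0 sd.
have cn : 'C(d, s)%:R != 0 :> R by rewrite pnatr_eq0 -lt0n bin_gt0.
have dn : d%:R != 0 :> R by rewrite pnatr_eq0 -lt0n.
apply/eqP; rewrite eqr_div // -!natrM; apply/eqP; congr _%:R.
by case: s s0 {sd cn} => // s _; rewrite mulnC mul_bin_diag.
Qed.

Lemma sum_by_bit (N d : nat) (j : 'I_d) (c : {ffun 'I_N -> {ffun 'I_d -> bool}})
    (F : bool -> R) :
  \sum_(k < N) F (c k j) =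
  #|[set k | c k j]%SET|%:R * F true
  + (N%:R - #|[set k | c k j]%SET|%:R) * F false.
Proof.
rewrite (bigID (fun k => c k j)) /=; congr (_ + _).
  rewrite (eq_bigr (fun=> F true)) => [|k ->//].
  rewrite (eq_bigl (mem [set k | c k j]%SET)) => [|k]; last by rewrite !inE.
  by rewrite sumr_const mulr_natl.
rewrite (eq_bigr (fun=> F false)) => [|k /negbTE->//].
rewrite (eq_bigl (mem (~: [set k | c k j])%SET)) => [|k]; last by rewrite !inE.
rewrite sumr_const -[LHS]mulr_natl cardsCs finset.setCK card_ord natrB //.
by rewrite -[X in (_ <= X)%N](card_ord N) max_card.
Qed.

End CandidateCounts.

(** * The squared error as a function of one bit *)

Section SquaredError.
Variable R : realType.
Implicit Types (d s m b v P : R).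

(* The squared error of an [s]-subset, as an affine function of the bit [v] at
   the input coordinate: the other [d - 1] bits enter only through their sum
   [s - v]. *)
Definition bit_err d s m b v : R :=
  (v * (1 - 2 * (b + m)) + (b + m) ^+ 2 + (s - v) * (1 - 2 * b)
   + (d - 1) * b ^+ 2) / m ^+ 2.

(** Bits are idempotent, so the square at each coordinate is affine in its bit. *)
Lemma sqerrE (d s : nat) (m b : R) (j : 'I_d) z : m != 0 -> z \in Zset d s ->
  sqerr m b j z = bit_err d%:R s%:R m b (z j)%:R.
Proof.
move=> m0; rewrite inE => /eqP zs; rewrite /sqerr (bigD1 j) //= eqxx.
rewrite (eq_bigr (fun i => (z i)%:R * ((1 - 2 * b) / m ^+ 2) + b ^+ 2 / m ^+ 2)).
  have sE : \sum_(i < d | i != j) (z i)%:R = s%:R - (z j)%:R :> R.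
    by rewrite -zs natr_sum [in RHS](bigD1 j) //= addrAC subrr add0r.
  rewrite big_split /= -mulr_suml sE sumr_const.
  have -> : #|[pred i | i != j]| = d.-1 by rewrite cardC1 card_ord.
  have -> : d.-1 = (d - 1)%N by rewrite subn1.
  rewrite -[_ *+ (d - 1)]mulr_natl natrB; last by case: d j {z zs sE} => [[]|].
  by rewrite /bit_err; case: (z j); rewrite /=; field.
move=> i /negbTE->; rewrite subr0.
by case: (z i); rewrite /=; field.
Qed.

(** An affine function commutes with averaging. This reduces an expected error to the mean of the
    bit at the input coordinate. *)
Lemma bit_err_mean (I : finType) (A : pred I) (w v : I -> R) d s m b :
  \sum_(i | A i) w i = 1 ->
  \sum_(i | A i) w i * bit_err d s m b (v i) =
  bit_err d s m b (\sum_(i | A i) w i * v i).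
Proof.
move=> w1; set L := bit_err d s m b.
have LE x : L x = L 0 + (L 1 - L 0) * x by rewrite /L /bit_err; ring.
rewrite [RHS]LE mulr_sumr -[L 0 in RHS]mul1r -{1}w1 mulr_suml -big_split.
by apply: eq_bigr => i _; rewrite LE /=; ring.
Qed.

(** By symmetry, the probability that a given coordinate other than the input one is set. As bias,
    with slope [P - prob_bias d s P], it makes the estimator unbiased. *)
Definition prob_bias d s P : R := (s - P) / (d - 1).

(** With [b = prob_bias d s P], the numerator equals [P (1 - P) + (d - 1) b (1 - b)], the sum of the
    variances of the [d] bits. *)
Definition prob_mse d s P : R :=
  (s - P ^+ 2 - (s - P) ^+ 2 / (d - 1)) / (P - prob_bias d s P) ^+ 2.

Lemma bit_err_prob d s P : d - 1 != 0 ->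
  bit_err d s (P - prob_bias d s P) (prob_bias d s P) P = prob_mse d s P.
Proof.
move=> d1; rewrite /bit_err /prob_mse; congr (_ / _).
by rewrite /prob_bias; field.
Qed.

End SquaredError.

(** * Bias and slope of MRC in terms of its hitting probability *)

Section MrcMoments.
Variables (R : realType) (N d s : nat) (eps : R).
Let P := Ebinom N (s%:R / d%:R) (g_mrc eps).

Lemma b_mrcE : b_mrc N d s eps = prob_bias R d%:R s%:R P.
Proof. by rewrite /b_mrc EbinomBl mulrC. Qed.

Lemma m_mrcE : m_mrc N d s eps = P - prob_bias R d%:R s%:R P.
Proof. by rewrite /m_mrc EbinomBl [_^-1 * _]mulrC. Qed.

End MrcMoments.

(** * Exact errors of the two mechanisms *)

Section Mechanisms.
Variables (R : realType) (d s : nat) (eps : R).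
Hypotheses (s_gt0 : (0 < s)%N) (s_lt_d : (s < d)%N) (eps_gt0 : 0 < eps).

Let d_gt1 : (1 < d)%N. Proof. exact: leq_ltn_trans s_lt_d. Qed.
Let E_gt1 : 1 < expR eps. Proof. by rewrite expR_gt1. Qed.
Let s_ge1R : 1 <= s%:R :> R. Proof. by rewrite ler1n. Qed.
Let s_leR : s%:R + 1 <= d%:R :> R. Proof. by rewrite natr1 ler_nat. Qed.

(** The closed forms [b_ss] and [m_ss] are the unbiased pair for the probability [Q] that the
    released subset contains [j]; the mean of that bit under [q_ss] is then computed from the two
    subset counts. *)
Lemma mse_ssE (j : 'I_d) :
  mse_ss s eps j = prob_mse R d%:R s%:R (g_mrc eps (s%:R / d%:R)).
Proof.
have [[E1 s1] sd] := (E_gt1, s_ge1R, s_leR).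
set E := expR eps in E1 *; set dr : R := d%:R in sd *.
set sr : R := s%:R in s1 sd *; set Q := g_mrc eps (sr / dr).
have den0 : sr * (E - 1) + dr != 0 by apply/lt0r_neq0; nra.
have d0 : dr != 0 by apply/lt0r_neq0; lra.
have d1 : dr - 1 != 0 by apply/lt0r_neq0; lra.
have QE : Q = E * sr / (sr * (E - 1) + dr).
  by rewrite /Q /g_mrc -/E; field; rewrite d0 den0.
have bE : b_ss d s eps = prob_bias R dr sr Q.
  by rewrite /b_ss /prob_bias QE -/E -/dr -/sr; field; rewrite d1 den0.
have mE : m_ss d s eps = Q - prob_bias R dr sr Q.
  by rewrite /m_ss /prob_bias QE -/E -/dr -/sr; field; rewrite d1 den0.
have m0 : m_ss d s eps != 0.
  rewrite /m_ss -/E -/dr -/sr; apply/lt0r_neq0/divr_gt0.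
    by apply: mulr_gt0; [apply: mulr_gt0|]; lra.
  by apply: mulr_gt0; [lra|nra].
rewrite -bit_err_prob // -mE -bE.
pose a : R := 'C(d.-1, s.-1)%:R; pose b : R := 'C(d.-1, s)%:R.
have a0 : 0 < a.
  by rewrite ltr0n bin_gt0 -ltnS !prednK // ltnW.
have b0 : 0 < b by rewrite ltr0n bin_gt0 -ltnS prednK // ltnW.
(* A uniform [s]-subset contains [j] with probability [a / (a + b) = s / d], where [a + b] is
   ['C(d, s)] by Pascal's rule. *)
have abE : a * dr = (a + b) * sr.
  have := card_Zset_ratio R d s j; rewrite s_gt0 ltnW // => /(_ isT).
  rewrite card_Zset_in // -/a -/dr -/sr => /eqP.
  rewrite eqr_div //; last first.
    by rewrite pnatr_eq0 -lt0n card_Zset bin_gt0 ltnW.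
  move=> /eqP ->; rewrite mulrC; congr (_ * _).
  rewrite card_Zset -natrD; congr _%:R.
  by case: (d) (s) s_gt0 d_gt1 => [|d'] [|s'] // _ _; rewrite binS addnC.
have D0 : a * E + b != 0 by apply/lt0r_neq0; nra.
pose q b' : R := (if b' : bool then E else 1) / (a * E + b).
have sumE (F : bool -> R) :
    \sum_(z in Zset d s) F (z j) = a * F true + b * F false.
  rewrite (bigID (fun z : {ffun 'I_d -> bool} => z j)) /=; congr (_ + _).
    rewrite (eq_bigr (fun=> F true)) => [|z /andP[_ ->] //].
    rewrite (eq_bigl (mem [set z in Zset d s | z j]%SET)) => [|z]; last by rewrite !inE.
    by rewrite sumr_const card_Zset_in // mulr_natl.
  rewrite (eq_bigr (fun=> F false)) => [|z /andP[_ /negbTE->] //].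
  rewrite (eq_bigl (mem [set z in Zset d s | ~~ z j]%SET)) => [|z]; last by rewrite !inE.
  by rewrite sumr_const card_Zset_notin mulr_natl.
rewrite /mse_ss (eq_bigr (fun z => q_ss s eps j z *
    bit_err R dr sr (m_ss d s eps) (b_ss d s eps) (z j)%:R)); last first.
  by move=> z zZ; rewrite (sqerrE R d s _ _ _ _ m0 zZ).
rewrite bit_err_mean; last first.
  by rewrite (sumE q) /q /=; field.
congr bit_err; rewrite (sumE (fun x => q x * x%:R)) QE /q /= mulr0 mulr0 addr0.
have -> : sr = a * dr / (a + b).
  by rewrite abE mulrAC mulfV ?mul1r //; apply/lt0r_neq0; lra.
have dr0 : 0 < dr by lra.
field; rewrite -/a -/b -/dr D0 andbT.
by apply/andP; split; apply/lt0r_neq0; [lra|nra].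
Qed.

(** If [n] of the [N] candidates contain [j], the selected one contains [j] with probability
    [g_mrc eps (n / N)]. Averaging over the binomial [n] gives the hitting probability. *)
Lemma mse_mrcE (N : nat) (j : 'I_d) : (0 < N)%N ->
  m_mrc N d s eps != 0 ->
  mse_mrc N s eps j =
  prob_mse R d%:R s%:R (Ebinom N (s%:R / d%:R) (g_mrc eps)).
Proof.
move=> N0 m0; have [[E1 s1] sd] := (E_gt1, s_ge1R, s_leR).
set P := Ebinom _ _ _.
have d1 : d%:R - 1 != 0 :> R by apply/lt0r_neq0; lra.
have Nn : N%:R != 0 :> R by rewrite pnatr_eq0 -lt0n.
rewrite -bit_err_prob // -m_mrcE -b_mrcE.
set L := bit_err R d%:R s%:R _ _.
(* For fixed candidates, the mean over [K] depends only on their count [n]; the normalisation of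
   [q_ss] cancels in [pi_mrc]. *)
transitivity (\sum_(c : {ffun 'I_N -> {ffun 'I_d -> bool}} |
    [forall k, c k \in Zset d s]) (#|Zset d s|%:R ^+ N)^-1 *
    (fun n : nat => L (g_mrc eps (n%:R / N%:R))) #|[set k | c k j]%SET|).
  rewrite /mse_mrc; apply: eq_big => [c|c]; first by rewrite inE.
  rewrite inE => /forallP cZ; congr (_ * _).
  rewrite (eq_bigr (fun k => pi_mrc s eps j c k * L (c k j)%:R)); last first.
    by move=> k _; rewrite (sqerrE R d s _ _ _ _ m0 (cZ k)).
  pose D : R := 'C(d.-1, s.-1)%:R * expR eps + 'C(d.-1, s)%:R.
  have D0 : D != 0.
    apply/lt0r_neq0; apply: ltr_wpDr => //; apply: mulr_gt0; last by lra.
    by rewrite ltr0n bin_gt0 -ltnS !prednK // ltnW.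
  pose q b' : R := (if b' : bool then expR eps else 1) / D.
  have nN : #|[set k | c k j]%SET|%:R <= N%:R :> R.
    by rewrite ler_nat -[X in (_ <= X)%N](card_ord N) max_card.
  have n0 : 0 <= #|[set k | c k j]%SET|%:R :> R by [].
  set n : R := #|[set k | c k j]%SET|%:R in nN n0 *.
  have Npos : 0 < N%:R :> R by rewrite ltr0n.
  have W0 : n * expR eps + (N%:R - n) != 0 by apply/lt0r_neq0; nra.
  have SE : \sum_(k' < N) q_ss s eps j (c k') = (n * expR eps + (N%:R - n)) / D.
    by rewrite (sum_by_bit R N d j c q) -/n /q /=; field.
  rewrite bit_err_mean /pi_mrc SE; last first.
    rewrite -mulr_suml SE mulfV // mulf_neq0 ?invr_eq0 //.
  congr bit_err.
  rewrite (sum_by_bit R N d j c (fun b' => q b' /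
    ((n * expR eps + (N%:R - n)) / D) * b'%:R)) -/n /q /= !mulr0 addr0 /g_mrc.
  by field; rewrite Nn D0 -/n [expR eps * n]mulrC W0.
rewrite (mean_indicator_count R _ N (Zset d s) (fun z => z j)
  (fun n => L (g_mrc eps (n%:R / N%:R)))); last by rewrite card_Zset bin_gt0 ltnW.
rewrite card_Zset_ratio; last by rewrite s_gt0 ltnW.
(* [L] is affine, so the binomial mean passes through it to [g_mrc]. *)
pose c1 := L 1 - L 0.
transitivity (binom_mean R N (s%:R / d%:R)
    (fun i => L 0 + c1 * g_mrc eps (i%:R / N%:R))).
  by apply: eq_bigr => i _; congr (_ * _); rewrite /c1 /L /bit_err; ring.
rewrite binom_meanD binom_meanZ binom_mean_cst -EbinomE -/P.
by rewrite /c1 /L /bit_err; ring.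
Qed.

End Mechanisms.

(** * Comparison of the two errors and the sample size *)

Section Comparison.
Variable R : realType.

(* The Taylor remainder of [g_mrc] at [p] is exactly
   [E * a * (t - p)^2 / ((1 + a p)^2 * (1 + a t))], with [E = exp eps], [a = E - 1]. *)
Lemma g_mrc_taylor (eps p t : R) (E := expR eps) (A := 1 + (E - 1) * p) :
  0 < eps -> 0 <= p <= 1 -> 0 <= t <= 1 ->
  g_mrc eps p + E / A ^+ 2 * (t - p) - E * (E - 1) / A ^+ 2 * (t - p) ^+ 2
    <= g_mrc eps t <= g_mrc eps p + E / A ^+ 2 * (t - p).
Proof.
move=> e0 /andP[p0 p1] /andP[t0 t1].
have E1 : 1 < E by rewrite /E expR_gt1.
have A1 : 1 <= A by rewrite /A; nra.
pose B := 1 + (E - 1) * t; have B1 : 1 <= B by rewrite /B; nra.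
pose r := E * (E - 1) / A ^+ 2 * (t - p) ^+ 2.
have r0 : 0 <= r.
  by apply: mulr_ge0; rewrite ?sqr_ge0 //; apply: divr_ge0;
    rewrite ?sqr_ge0 // mulr_ge0; lra.
have An : A != 0 by apply/lt0r_neq0; lra.
have Bn : B != 0 by apply/lt0r_neq0; lra.
have gE : g_mrc eps t = g_mrc eps p + E / A ^+ 2 * (t - p) - r / B.
  rewrite /g_mrc -/E /r /B /A; field.
  by rewrite -/A -/B An Bn.
(* The exact remainder is [r / B]; since [B >= 1], it lies between [0] and [r]. *)
have rB : 0 <= r / B <= r.
  apply/andP; split; first by apply: divr_ge0 => //; lra.
  by rewrite ler_pdivrMr; [nra|lra].
by rewrite gE -/r; lra.
Qed.

(** Average both Taylor bounds at the mean [p]: the linear term vanishes and the quadratic one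
    becomes the variance. *)
Lemma Ebinom_g_mrc_gap (N : nat) (eps p : R) (A := 1 + (expR eps - 1) * p) :
  (0 < N)%N -> 0 < eps -> 0 <= p <= 1 ->
  0 <= g_mrc eps p - Ebinom N p (g_mrc eps)
    <= expR eps / (N%:R * A) * (g_mrc eps p - p).
Proof.
move=> N0 e0 p01.
have E1 : 1 < expR eps by rewrite expR_gt1.
set E := expR eps in A E1 *.
have Nn : N%:R != 0 :> R by rewrite pnatr_eq0 -lt0n.
have /andP[p0 p1] := p01.
have A1 : 1 <= A by rewrite /A; nra.
have An : A != 0 by apply/lt0r_neq0; lra.
have affE c0 c1 c2 : Ebinom N p (fun t => c0 + c1 * (t + - p) + c2 * (t - p) ^+ 2)
    = c0 + c2 * (p * (1 - p) / N%:R).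
  rewrite !EbinomD !EbinomZ EbinomD !Ebinom_cst Ebinom_id // Ebinom_variance //.
  by ring.
apply/andP; split.
  have := affE (g_mrc eps p) (E / A ^+ 2) 0; rewrite mul0r addr0 subr_ge0 => <-.
  apply: Ebinom_le => // t t01; rewrite mul0r addr0.
  by have /andP[] := g_mrc_taylor eps p t e0 p01 t01.
rewrite lerBlDr addrC -lerBlDr.
have := affE (g_mrc eps p) (E / A ^+ 2) (- (E * (E - 1) / A ^+ 2)).
(* The variance term is rewritten as a multiple of [g_mrc eps p - p = p (1 - p) (E - 1) / A], so
   that the loss is relative to the slope. *)
have -> : g_mrc eps p + - (E * (E - 1) / A ^+ 2) * (p * (1 - p) / N%:R) =
    g_mrc eps p - E / (N%:R * A) * (g_mrc eps p - p).
  rewrite /g_mrc -/E (_ : E * p + (1 - p) = A); last by rewrite /A; ring.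
  rewrite (_ : E * p / A - p = p * (1 - p) * (E - 1) / A); first by field; rewrite An Nn.
  by rewrite /A; field.
move=> <-; apply: Ebinom_le => // t t01; rewrite mulNr.
by have /andP[] := g_mrc_taylor eps p t e0 p01 t01.
Qed.

(* [prob_mse] has numerator [V P = s - P^2 - (s - P)^2 / (d - 1)], and
   [V P - V Q = (Q - P) (m P + m Q)] for the slope [m]; since [Q (1 - Q) <= V Q]
   this difference is of the relative order of [Q - P]. *)
Lemma prob_mse_le (d s E n lambda P : R)
    (p := s / d) (A := 1 + (E - 1) * p) (Q := E * p / A) :
  1 <= s -> s + 1 <= d -> 1 < E -> 0 < lambda ->
  2 * E * (1 + lambda) <= lambda * n ->
  0 <= Q - P <= E / (n * A) * (Q - p) ->
  0 < P - prob_bias R d s P /\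
  prob_mse R d s P <= (1 + lambda) ^+ 2 * (1 + 2 * lambda) * prob_mse R d s Q.
Proof.
move=> s1 sd E1 l0 nE /andP[QP0 QP].
have d1 : 0 < d - 1 by lra.
have d0 : 0 < d by lra.
have p0 : 0 < p by apply: divr_gt0; lra.
have p1 : p < 1 by rewrite /p ltr_pdivrMr; lra.
have n0 : 0 < n by rewrite -(pmulr_rgt0 _ l0); nra.
have A1 : 1 < A by rewrite /A; nra.
have A0 : 0 < A by lra.
have [An dn d1n nn En] : [/\ A != 0, d != 0, d - 1 != 0, n != 0 & E != 0].
  by split; apply/lt0r_neq0 => //; lra.
pose D := d / (d - 1).
have D0 : 0 < D by apply: divr_gt0.
have slopeE x : x - prob_bias R d s x = D * (x - p).
  by rewrite /prob_bias /D /p; field; rewrite dn d1n.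
have QpE : Q - p = p * (1 - p) * (E - 1) / A.
  by rewrite /Q; apply: (mulIf An); rewrite mulrBl !mulfVK //; rewrite /A; ring.
have Qp0 : 0 < Q - p.
  by rewrite QpE; apply: divr_gt0 => //; apply: mulr_gt0; [apply: mulr_gt0|]; lra.
pose del := E / (n * A).
have delE : del * A = E / n by rewrite /del; field; rewrite nn An.
have del0 : 0 < del by apply: divr_gt0; [lra|apply: mulr_gt0].
have En0 : E / n * (2 * (1 + lambda)) <= lambda.
  by rewrite mulrAC ler_pdivrMr //; lra.
have delEn : del <= E / n by rewrite -delE; nra.
have del_small : (1 + lambda) * del <= lambda by nra.
(* From [(1 + lambda) * del <= lambda]: the slope shrinks by a factor of at most [1 + lambda]. *)
have Pp : Q - p <= (1 + lambda) * (P - p).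
  have : (1 + lambda) * (Q - P) <= lambda * (Q - p).
    apply: (@le_trans _ _ ((1 + lambda) * (del * (Q - p)))).
      by apply: ler_wpM2l => //; lra.
    by rewrite mulrA; apply: ler_wpM2r => //; lra.
  by lra.
have Pp0 : 0 < P - p by nra.
split; first by rewrite slopeE; apply: mulr_gt0.
pose V x := s - x ^+ 2 - (s - x) ^+ 2 / (d - 1).
have mseE x : prob_mse R d s x = V x / (D * (x - p)) ^+ 2.
  by rewrite /prob_mse slopeE.
have Q1 : 1 - Q = (1 - p) / A.
  by rewrite /Q; apply: (mulIf An); rewrite mulrBl !mulfVK //; rewrite /A; ring.
have Q1p : 0 < 1 - Q by rewrite Q1; apply: divr_gt0; lra.
have Q0 : 0 < Q by lra.
(* The discarded term is the total variance of the other [d - 1] bits, nonnegative since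
   [0 <= s - Q <= d - 1]. *)
have VQ : Q * (1 - Q) <= V Q.
  have -> : V Q = Q * (1 - Q) + (s - Q) * (d - 1 - (s - Q)) / (d - 1).
    by rewrite /V; field.
  by rewrite lerDl; apply: divr_ge0; [apply: mulr_ge0|]; lra.
(* The left side is [(d - s) / (d - 1)], and [s >= 1]. *)
have DpE : D * (1 - p) <= 1.
  by rewrite /D /p -mulrA (mulrC _^-1) mulrA ler_pdivrMr // mulrBr mulr1 mulrCA mulfV //; lra.
(* After factoring out [Q (1 - Q)], the remaining factors satisfy [D (1 - p) <= 1],
   [(E - 1) / E <= 1] and [p (E - 1) = A - 1]. The resulting [A] cancels the one in [del]. *)
have QpQ : D * (Q - p) ^+ 2 <= Q * (1 - Q) * A.
  have Q1Q0 : 0 < Q * (1 - Q) by apply: mulr_gt0.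
  have -> : D * (Q - p) ^+ 2 =
      Q * (1 - Q) * (D * (1 - p) * (p * (E - 1) * ((E - 1) / E))).
    by rewrite QpE Q1 /Q; field; rewrite An En.
  rewrite ler_pM2l //.
  have E01 : 0 <= (E - 1) / E <= 1.
    by rewrite divr_ge0 ?ler_pdivrMr; lra.
  have X0 : 0 <= p * (E - 1) * ((E - 1) / E) by apply: mulr_ge0; [apply: mulr_ge0|]; lra.
  apply: (@le_trans _ _ (p * (E - 1) * ((E - 1) / E))).
    by rewrite -[leRHS]mul1r; apply: ler_wpM2r.
  apply: (@le_trans _ _ (p * (E - 1))); last by rewrite /A; lra.
  by rewrite -[leRHS]mulr1; apply: ler_wpM2l; [apply: mulr_ge0|]; lra.
have VP : V P <= (1 + 2 * lambda) * V Q.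
  have -> : V P = V Q + (Q - P) * (D * (P - p) + D * (Q - p)).
    by rewrite -!slopeE /V /prob_bias; field.
  have step1 : (Q - P) * (D * (P - p) + D * (Q - p)) <=
      del * (Q - p) * (2 * D * (Q - p)).
    apply: ler_pM => //; first by rewrite -mulrDr; apply: mulr_ge0; lra.
    by nra.
  have step2 : del * (D * (Q - p) ^+ 2) <= del * (Q * (1 - Q) * A).
    by apply: ler_wpM2l => //; lra.
  have step3 : Q * (1 - Q) * (E / n) <= V Q * lambda.
    apply: ler_pM => //.
    - by apply: mulr_ge0; lra.
    - by apply: divr_ge0; lra.
    - have := En0; have : 0 <= E / n by apply: divr_ge0; lra.
      by nra.
  by move: step2 step3; rewrite -delE; lra.
have VQ0 : 0 <= V Q by apply: le_trans VQ; apply: mulr_ge0; lra.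
rewrite !mseE ler_pdivrMr; last by apply: exprn_gt0; apply: mulr_gt0.
apply: (le_trans VP).
(* Isolates the ratio of slopes, which is at least [1] by [Pp]. *)
have -> : (1 + lambda) ^+ 2 * (1 + 2 * lambda) * (V Q / (D * (Q - p)) ^+ 2) *
    (D * (P - p)) ^+ 2 =
    (1 + 2 * lambda) * V Q * ((1 + lambda) * (P - p) / (Q - p)) ^+ 2.
  by field; rewrite !lt0r_neq0.
rewrite -[leLHS]mulr1; apply: ler_wpM2l; first by apply: mulr_ge0; lra.
by rewrite exprn_ege1 // ler_pdivlMr // mul1r.
Qed.

(** A crude consequence suffices: the logarithm is at least [1 / 2], the numerical factor
    [2 / 0.24 ^ 2] exceeds [2], and [(E + 3) ^ 2 * r ^ 2] dominates [2 * E * r] because [r >= 1]. *)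
Lemma sample_size_bound (E lambda n : R) : 1 < E -> 0 < lambda ->
  (2 * (E + 3) ^+ 2 * (1 + lambda) ^+ 2) / ((24 / 100) ^+ 2 * lambda ^+ 2)
    * ln ((8 * (1 + lambda)) / ((24 / 100) * lambda)) <= n ->
  2 * E * (1 + lambda) <= lambda * n.
Proof.
move=> E1 l0 nE.
set x := (8 * _) / _ in nE.
have x2 : 2 <= x by rewrite /x ler_pdivlMr; lra.
(* Uses [ln x = - ln (1 / x) >= 1 - 1 / x]. *)
have ln_ge : 1 / 2 <= ln x.
  have xV : x^-1 <= 1 / 2 by rewrite -div1r ler_pdivrMr; lra.
  have xV0 : 0 < x^-1 by rewrite invr_gt0; lra.
  have := @le_ln1Dx R (x^-1 - 1); rewrite addrCA subrr addr0 lnV ?posrE; lra.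
have l1 : 1 <= (1 + lambda) / lambda by rewrite ler_pdivlMr; lra.
set r := (1 + lambda) / lambda in l1.
have cE : (2 * (E + 3) ^+ 2 * (1 + lambda) ^+ 2) / ((24 / 100) ^+ 2 * lambda ^+ 2)
    = 2 / (24 / 100) ^+ 2 * (E + 3) ^+ 2 * r ^+ 2.
  by rewrite /r; field; lra.
rewrite cE in nE.
suff : 2 * E * r <= n by rewrite /r mulrA ler_pdivrMr // [n * _]mulrC.
apply: le_trans nE.
have c0 : 2 * E * r <= (E + 3) ^+ 2 * r ^+ 2 by apply: ler_pM; nra.
have cn : 0 <= (E + 3) ^+ 2 * r ^+ 2 by rewrite mulr_ge0 ?sqr_ge0.
have := ler_wpM2l cn ln_ge.
by lra.
Qed.

(** Since [expR eps > 1] and [d >= 2], the ratio inside the ceiling is positive and below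
    [d / 2 <= d - 1]. *)
Lemma ss_s_bounds (d : nat) (eps : R) : (2 <= d)%N -> 0 < eps ->
  (0 < ss_s d eps < d)%N.
Proof.
move=> d2 e0; have E1 : 1 < expR eps by rewrite expR_gt1.
have d2R : 2 <= d%:R :> R by rewrite ler_nat.
have x0 : 0 < d%:R / (1 + expR eps) by apply: divr_gt0; lra.
have c0 : 0 < Num.ceil (d%:R / (1 + expR eps)) by rewrite ceil_gt0.
have sE : Posz (ss_s d eps) = Num.ceil (d%:R / (1 + expR eps)).
  by rewrite /ss_s gez0_abs // ltW.
apply/andP; split; first by rewrite -ltz_nat sE.
case: d d2 d2R x0 c0 sE => // d d2 d2R x0 c0 sE.
rewrite ltnS -lez_nat sE ceil_le_int ler_pdivrMr; last by lra.
by rewrite -natr1 in d2R *; nra.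
Qed.

End Comparison.

Theorem theorem11 (R : realType) (d : nat) (eps lambda : R) (N : nat) :
  (2 <= d)%N -> 1 <= eps -> 0 < lambda ->
  (2 * (expR eps + 3) ^+ 2 * (1 + lambda) ^+ 2) / ((24 / 100) ^+ 2 * lambda ^+ 2)
    * ln ((8 * (1 + lambda)) / ((24 / 100) * lambda)) <= N%:R ->
  forall j : 'I_d,
    mse_mrc N (ss_s d eps) eps j <=
    (1 + 4 * lambda + 5 * lambda ^+ 2 + 2 * lambda ^+ 3) * mse_ss (ss_s d eps) eps j.
Proof.
move=> d2 eps1 l0 NE j.
have e0 : 0 < eps by lra.
have E1 : 1 < expR eps by rewrite expR_gt1.
have /andP[s0 sd] := ss_s_bounds R d eps d2 e0.
have nE := sample_size_bound R _ _ _ E1 l0 NE.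
(* [N = 0] would contradict [nE], whose left side is positive. *)
have N0 : (0 < N)%N by rewrite -(ltr0n R) -(pmulr_rgt0 _ l0); nra.
set s := ss_s d eps in s0 sd *.
have s1 : 1 <= s%:R :> R by rewrite ler1n.
have sdR : s%:R + 1 <= d%:R :> R by rewrite natr1 ler_nat.
have p01 : 0 <= (s%:R / d%:R : R) <= 1 by rewrite divr_ge0 ?ler_pdivrMr; lra.
have QE : g_mrc eps (s%:R / d%:R) = expR eps * (s%:R / d%:R) /
    (1 + (expR eps - 1) * (s%:R / d%:R)).
  by rewrite /g_mrc; congr (_ / _); ring.
have := Ebinom_g_mrc_gap R N eps _ N0 e0 p01; rewrite QE.
move=> /(prob_mse_le R _ _ _ _ _ _ s1 sdR E1 l0 nE)[m0 mse_le].
rewrite mse_mrcE // ?mse_ssE // ?m_mrcE ?lt0r_neq0 // QE.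
by apply: le_trans mse_le _; rewrite le_eqVlt; apply/orP; left; apply/eqP; ring.
Qed.
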